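(* Let $\mathbb{A}=\mathbb{A}_\chi(\mathcal{M})$ be a $\chi$-algebra on a matroid $\mathcal{M}$ on $[n]$ and suppose $\mathbb{I}_\ell$ is a diagonal basis of $\mathbb{A}_\ell$. Then $\mathbb{I}_\ell$ is a basis of $\mathbb{A}_\ell$, and $\mathbb{I}_\ell^*:=\{\mathfrak{p}_{I^{\sigma_I}}:[I]_{\mathbb{A}}\in\mathbb{I}_\ell\}$ is the dual basis of $\mathbb{I}_\ell$ (i.e. $\mathfrak{p}_{I^{\sigma_I}}([J]_{\mathbb{A}})=\delta_{IJ}$ for $[I]_{\mathbb{A}},[J]_{\mathbb{A}}\in\mathbb{I}_\ell$).
   Context: $\mathcal{M}$ is a matroid on $[n]=\{1,\dots,n\}$ with closure $\mathrm{cl}$; $\mathbb{K}$ a field. $\mathcal{E}$ is the graded $\mathbb{K}$-algebra generated by $1,e_1,\dots,e_n$ with $e_i^2=0$ and $e_je_i=\beta_{i,j}e_ie_j$ ($i<j$, $\beta_{i,j}\in\mathbb{K}\setminus0$ fixed); $e_X=e_{i_1}\cdots e_{i_m}$ for $X=\{i_1<\dots<i_m\}$. Ordered sets $X^\sigma$ are listings of $X$ (unordered sets taken increasingly), $*$ is concatenation, and $\chi:2^{[n]}\to\mathbb{K}$ extends by $\chi(X^\sigma)=\mathrm{sgn}(\sigma)\chi(X)$. $\partial e_X=\sum_{p=1}^m(-1)^p\chi(X\setminus i_p)e_{X\setminus i_p}$. A unidependent is a set containing exactly one circuit. $\Im_\chi(\mathcal{M})$ is the right ideal generated by $\partial e_C$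 ($C$ a circuit, $|C|>1$) and $e_i$ ($i$ a loop); $\mathbb{A}_\chi(\mathcal{M})=\mathcal{E}/\Im_\chi(\mathcal{M})$ is a $\chi$-algebra if (UC1) $\chi(I)\ne0$ iff $I$ independent, (UC2) for unidependents $U'\subseteq U$ there is $\varepsilon_{U,U'}\ne0$ with $\partial e_U=\varepsilon_{U,U'}(\partial e_{U'})e_{U\setminus U'}$. $[X]_{\mathbb{A}}$ (or $e_X$) is the class of $e_X$; $\mathbb{A}_\ell$ is the degree-$\ell$ part, spanned by $[I]_{\mathbb{A}}$ with $I$ independent, $|I|=\ell$; $\mathbb{A}_0=\mathbb{K}$. For a non-loop $x$, $\mathcal{M}/x$ carries the $\chi$-algebra with $\chi_{\mathcal{M}/x}(I)=\chi(I*x)$ (generators $e_i$, $i\ne x$), and $\mathfrak{p}_x:\mathbb{A}(\mathcal{M})\to\mathbb{A}(\mathcal{M}/x)$ is linear with, for $I$ independent: $\mathfrak{p}_x(e_I)=e_{I\setminus x}$ if $x\in I$; $=\frac{\chi((I\setminus y)*x)}{\chi((I\setminus y)*y)}e_{I\setminus y}$ if some $y\in I$ is parallel to $x$; $=0$ otherwise; this applies iteratively to successive contractions. For an ordered independent $I^\sigma=(i_{\sigma(1)},\dots,i_{\sigma(\ell)})$, $\mathfrak{p}_{I^\sigma}=\mathfrak{p}_{i_{\sigma(1)}}\circ\cdots\circ\mathfrak{p}_{i_{\sigma(\ell)}}:\mathbb{A}_\ell\to\mathbb{K}$ (rightmost applied first). $\mathbf{Flag}(I^\sigma)$ is the chain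 $\mathrm{cl}(\{i_{\sigma(\ell)}\})\subsetneq\mathrm{cl}(\{i_{\sigma(\ell)},i_{\sigma(\ell-1)}\})\subsetneq\cdots\subsetneq\mathrm{cl}(I)$. A subset $\mathbb{I}_\ell\subseteq\{[I]_{\mathbb{A}}:I\text{ independent},|I|=\ell\}$ is a diagonal basis of $\mathbb{A}_\ell$ if: (1) to each $[I]_{\mathbb{A}}\in\mathbb{I}_\ell$ a permutation $\sigma_I\in S_\ell$ of $I$ is fixed; (2) $|\mathbb{I}_\ell|\ge\dim\mathbb{A}_\ell$; (3) for all $[I]_{\mathbb{A}},[J]_{\mathbb{A}}\in\mathbb{I}_\ell$ and all $\tau\in S_\ell$, $\mathbf{Flag}(J^\tau)=\mathbf{Flag}(I^{\sigma_I})$ implies $J=I$. *)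

(* Defs.v *)
From HB Require Import structures.
From mathcomp Require Import all_boot all_order all_algebra all_fingroup all_field.
From mathcomp Require Import ring.

Set Implicit Arguments.
Unset Strict Implicit.
Unset Printing Implicit Defensive.

Import GRing.Theory.
Local Open Scope ring_scope.

(* Matroids, with an explicit ground set inside a finite type so that          *)
(* contractions of a matroid on T stay over the same type T.                   *)

Record matroid (T : finType) := Matroid {
  ground : {set T};
  indep : {set {set T}};
  indep_ground : forall I, I \in indep -> I \subset ground;
  indep0 : set0 \in indep;
  indepS : forall I J : {set T}, I \subset J -> J \in indep -> I \in indep;
  indep_exchange : forall I J : {set T}, I \in indep -> J \in indep ->
    (#|I| < #|J|)%N -> exists2 x, x \in J :\: I & x |: I \in indep
}.

Section MatroidTheory.
Variables (T : finType) (M : matroid T).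
Implicit Types (X C U : {set T}) (x y : T).

Definition rank X : nat := \max_(I in indep M | I \subset X) #|I|.

Definition cl X : {set T} := [set x in ground M | rank (x |: X) == rank X].

Definition circuit C : bool :=
  minset [pred X : {set T} | (X \subset ground M) && (X \notin indep M)] C.

Definition loop x : bool := circuit [set x].

Definition parallel x y : bool := (x != y) && circuit [set x; y].

Definition unidependent U : bool :=
  (U \subset ground M) &&
  (#|[set C : {set T} | circuit C && (C \subset U)]| == 1).

(* When x is not a non-loop of M, M / x is the deletion of x from M.           *)
Definition contract_ground x : {set T} := ground M :\ x.

Definition contract_indep x : {set {set T}} :=
  [set I : {set T} | (I \subset ground M :\ x) &&
     ((if [set x] \in indep M then x |: I else I) \in indep M)].

Fact contract_indep_ground x I :
  I \in contract_indep x -> I \subset contract_ground x.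
Proof. by rewrite inE => /andP[]. Qed.

Fact contract_indep0 x : set0 \in contract_indep x.
Proof.
by rewrite inE sub0set setU0; case: ifP => //= _; apply: indep0.
Qed.

Fact contract_indepS x (I J : {set T}) :
  I \subset J -> J \in contract_indep x -> I \in contract_indep x.
Proof.
rewrite !inE => sIJ /andP[sJ iJ]; rewrite (subset_trans sIJ sJ) /=.
by move: iJ; case: ifP => _ /=; apply: indepS; rewrite ?setUS.
Qed.

Fact contract_indep_exchange x (I J : {set T}) :
    I \in contract_indep x -> J \in contract_indep x -> (#|I| < #|J|)%N ->
  exists2 y, y \in J :\: I & y |: I \in contract_indep x.
Proof.
rewrite !inE => /andP[sI iI] /andP[sJ iJ] ltIJ.
have xI : x \notin I by apply/negP => /(subsetP sI); rewrite !inE eqxx.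
have xJ : x \notin J by apply/negP => /(subsetP sJ); rewrite !inE eqxx.
case: (boolP ([set x] \in indep M)) iI iJ => [ix|ix] iI iJ.
  have [|y] := indep_exchange iI iJ; first by rewrite !cardsU1 xI xJ.
  rewrite !inE negb_or => /andP[/andP[/negbTE yx yI]]; rewrite yx /= => yJ iy.
  exists y; rewrite !inE ?yI ?yJ // ix setUCA iy andbT.
  by rewrite subUset sub1set (subsetP sJ).
have [y] := indep_exchange iI iJ ltIJ.
rewrite inE => /andP[yI yJ] iy; exists y; rewrite !inE ?yI ?yJ //.
by rewrite (negbTE ix) iy andbT subUset sub1set (subsetP sJ).
Qed.

Definition contract x : matroid T :=
  Matroid (@contract_indep_ground x) (contract_indep0 x)
          (@contract_indepS x) (@contract_indep_exchange x).

(* Flag(i_1, ..., i_l) is cl{i_l}, cl{i_l, i_(l-1)}, ..., cl{i_l, ..., i_1}.   *)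
Definition flag (s : seq T) : seq {set T} :=
  [seq cl [set i in take k.+1 (rev s)] | k <- iota 0 (size s)].

End MatroidTheory.

(* Ordered sets: the listing X^sigma = (i_sigma(1), ..., i_sigma(m)) of        *)
(* X = {i_1 < ... < i_m}; enum_val enumerates a subset of 'I_n increasingly.   *)

Definition listing n (X : {set 'I_n}) (s : 'S_#|X|) : seq 'I_n :=
  [seq enum_val (s k) | k <- enum 'I_#|X|].

Lemma listing_inj n (X : {set 'I_n}) : injective (@listing n X).
Proof.
move=> s t /eq_in_map st; apply/permP => k.
by apply: enum_val_inj; apply: st; rewrite mem_enum.
Qed.

Lemma listing_set n (X : {set 'I_n}) (s : 'S_#|X|) :
  [set i in listing s] = X.
Proof.
apply/setP => i; rewrite inE; apply/mapP/idP => [[k _ ->]|iX].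
  exact: enum_valP.
exists ((s^-1)%g (enum_rank_in iX i)); first by rewrite mem_enum.
by rewrite permKV enum_rankK_in.
Qed.

Section Chi.
Variables (K : fieldType) (n : nat) (chi : {set 'I_n} -> K).

(* The sum has exactly one term when s has no repetition (none otherwise).     *)
Definition chi_ext (s : seq 'I_n) : K :=
  let X := [set i in s] in
  \sum_(sg : 'S_#|X| | listing sg == s) (-1) ^+ sg * chi X.

Lemma chi_ext_listing (X : {set 'I_n}) (s : 'S_#|X|) :
  chi_ext (listing s) = (-1) ^+ s * chi X.
Proof.
have chiX Y : Y = X ->
    \sum_(sg : 'S_#|Y| | listing sg == listing s) (-1) ^+ sg * chi Y
    = (-1) ^+ s * chi X.
  by move=> ->; apply: big_pred1 => sg; rewrite (inj_eq (@listing_inj n X)).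
exact: chiX (listing_set s).
Qed.

Definition chi_contract (x : 'I_n) (X : {set 'I_n}) : K :=
  chi_ext (rcons (enum X) x).

End Chi.

(* The algebra E generated by e_0, ..., e_(n-1) with e_i ^ 2 = 0 and           *)
(* e_j e_i = beta_(i,j) e_i e_j for i < j, in coordinates on the monomials     *)
(* e_X: e_X e_Y is 0 when X meets Y, and otherwise sorting the concatenation   *)
(* contributes a factor beta_(j,i) for each i in X and j in Y with j < i.      *)

Definition qext (K : fieldType) (n : nat) (beta : 'I_n -> 'I_n -> K) : Type :=
  {ffun {set 'I_n} -> K^o}.

Section QExt.
Variables (K : fieldType) (n : nat) (beta : 'I_n -> 'I_n -> K).
Local Notation E := (qext beta).
Implicit Types (X Y Z : {set 'I_n}) (f g h : E).

HB.instance Definition _ := Vector.on E.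

Definition qcoef X Y : K :=
  \prod_(i in X) \prod_(j in Y | (j < i)%N) beta j i.

Definition qext_one : E := [ffun Z : {set 'I_n} => (Z == set0)%:R].

Definition qext_mul f g : E :=
  [ffun Z : {set 'I_n} => \sum_(X : {set 'I_n} | X \subset Z)
               qcoef X (Z :\: X) * f X * g (Z :\: X)].

Lemma qcoef0l Y : qcoef set0 Y = 1.
Proof. by rewrite /qcoef big_set0. Qed.

Lemma qcoef0r X : qcoef X set0 = 1.
Proof.
rewrite /qcoef big1 // => i _; apply: big_pred0 => j; by rewrite inE.
Qed.

Lemma setU_setD X Z : X \subset Z -> X :|: (Z :\: X) = Z.
Proof.
move=> /subsetP sXZ; apply/setP => i; rewrite !inE.
by case: (boolP (i \in X)) => //= /sXZ.
Qed.

Lemma qcoefUl X Y Z : [disjoint X & Y] ->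
  qcoef (X :|: Y) Z = qcoef X Z * qcoef Y Z.
Proof.
move=> dXY; rewrite /qcoef -bigU //=; apply: eq_bigl => i; by rewrite !inE.
Qed.

Lemma qcoefUr X Y Z : [disjoint Y & Z] ->
  qcoef X (Y :|: Z) = qcoef X Y * qcoef X Z.
Proof.
move=> dYZ; rewrite /qcoef -big_split /=; apply: eq_bigr => i _.
by rewrite !big_mkcondr /= -bigU //=; apply: eq_bigl => j; rewrite !inE.
Qed.

Fact qext_mul1r : left_id qext_one qext_mul.
Proof.
move=> f; apply/ffunP => Z; rewrite ffunE (bigD1 set0) ?sub0set //=.
rewrite qcoef0l ffunE eqxx !mul1r setD0 big1 ?addr0 // => X /andP[_ /negbTE X0].
by rewrite ffunE X0 mulr0 mul0r.
Qed.

Fact qext_mulr1 : right_id qext_one qext_mul.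
Proof.
move=> f; apply/ffunP => Z; rewrite ffunE (bigD1 Z) //=.
rewrite setDv qcoef0r ffunE eqxx mul1r mulr1 big1 ?addr0 // => X /andP[sXZ neX].
rewrite ffunE setD_eq0; case: (boolP (Z \subset X)) => sZX; last by rewrite mulr0.
by case/eqP: neX; apply/eqP; rewrite eqEsubset sXZ.
Qed.

Fact qext_mulDl : left_distributive qext_mul +%R.
Proof.
move=> f g h; apply/ffunP => Z; rewrite !ffunE -big_split /=.
by apply: eq_bigr => X _; rewrite ffunE mulrDr mulrDl.
Qed.

Fact qext_mulDr : right_distributive qext_mul +%R.
Proof.
move=> f g h; apply/ffunP => Z; rewrite !ffunE -big_split /=.
by apply: eq_bigr => X _; rewrite ffunE mulrDr.
Qed.

Fact qext_mulA : associative qext_mul.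
Proof.
move=> f g h; apply/ffunP => Z; rewrite !ffunE.
under eq_bigr => X sXZ do rewrite ffunE big_distrr /=.
under [RHS]eq_bigr => W sWZ do rewrite ffunE mulrAC big_distrr /=.
rewrite [RHS](exchange_big_dep (fun X => X \subset Z)) /=; last first.
  by move=> W X sWZ sXW; apply: subset_trans sWZ.
apply: eq_bigr => X sXZ.
rewrite (reindex_onto (fun W => W :\: X) (fun Y => X :|: Y)) /=; last first.
  move=> Y; rewrite subsetD => /andP[_ dYX].
  by rewrite setDUl setDv set0U; apply/setDidPl.
apply: eq_big => [W|W].
  apply/andP/andP => [[sWX /eqP eW]|[sWZ sXW]].
    rewrite -eW subUset sXZ subsetUl; split=> //.
    by apply: subset_trans sWX _; apply: subsetDl.
  by rewrite setSD //; split=> //; rewrite setU_setD.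
move=> /andP[sWX /eqP eW]; set Y := W :\: X in sWX eW *.
have eYZ : (Z :\: X) :\: Y = Z :\: W by rewrite setDDl eW.
rewrite eYZ.
have dXY : [disjoint X & Y] by rewrite disjoint_sym disjoints_subset subsetDr.
have dYZ : [disjoint Y & Z :\: W].
  by rewrite disjoint_sym disjoints_subset -eW setDE subIset // setCS subsetUr orbT.
have -> : Z :\: X = Y :|: (Z :\: W).
  by rewrite -eYZ setU_setD.
rewrite -[in RHS]eW qcoefUl // qcoefUr // eW.
move: (qcoef X Y) (qcoef X _) (qcoef Y _) (f X : K) (g Y : K) (h _ : K).
by move=> a b c u v w; ring.
Qed.

Fact qext_one_neq0 : qext_one != 0.
Proof. by apply/eqP => /ffunP/(_ set0)/eqP; rewrite !ffunE eqxx oner_eq0. Qed.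

HB.instance Definition _ := GRing.Zmodule_isNzRing.Build E
  qext_mulA qext_mul1r qext_mulr1 qext_mulDl qext_mulDr qext_one_neq0.

Fact qext_scaleAl (a : K) f g : a *: (f * g) = (a *: f) * g.
Proof.
apply/ffunP => Z; rewrite !ffunE /= scaler_sumr; apply: eq_bigr => X _.
by rewrite ffunE /GRing.scale /= !mulrA (mulrC a).
Qed.

HB.instance Definition _ := GRing.Lmodule_isLalgebra.Build K E qext_scaleAl.

Fact qext_scaleAr (a : K) f g : a *: (f * g) = f * (a *: g).
Proof.
apply/ffunP => Z; rewrite !ffunE /= scaler_sumr; apply: eq_bigr => X _.
by rewrite ffunE /GRing.scale /= mulrCA.
Qed.

HB.instance Definition _ := GRing.Lalgebra_isAlgebra.Build K E qext_scaleAr.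
HB.instance Definition _ := Algebra_isFalgebra.Build K E.


Definition qgen (i : 'I_n) : E := [ffun Z : {set 'I_n} => (Z == [set i])%:R].

Definition emon X : E := \prod_(i <- enum X) qgen i.

Lemma mul_delta X Y : [disjoint X & Y] ->
  ([ffun Z : {set 'I_n} => (Z == X)%:R] : E) * ([ffun Z : {set 'I_n} => (Z == Y)%:R] : E)
  = qcoef X Y *: ([ffun Z : {set 'I_n} => (Z == X :|: Y)%:R] : E).
Proof.
move=> dXY; apply/ffunP => Z; rewrite !ffunE /=.
case: eqP => [->|neZ].
  rewrite (bigD1 X) ?subsetUl //= !ffunE eqxx big1 ?addr0 => [|W /andP[_ /negbTE WX]].
    rewrite setDUl setDv set0U.
    rewrite disjoint_sym in dXY; rewrite (setDidPl dXY) ?ffunE eqxx mulr1.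
    by rewrite [LHS]mulr1 [RHS]mulr1.
  by rewrite ffunE WX mulr0 mul0r.
rewrite [RHS]mulr0 big1 // => W sWZ; rewrite !ffunE.
case: eqP => [eW|_]; last by rewrite mulr0 mul0r.
case: eqP => [eY|_]; last by rewrite mulr0.
by case: neZ; rewrite -eY -eW setU_setD.
Qed.

Lemma qgen_sqr i : qgen i * qgen i = 0.
Proof.
apply/ffunP => Z; rewrite !ffunE /= big1 // => W sWZ; rewrite !ffunE.
case: eqP => [->|_]; last by rewrite mulr0 mul0r.
case: eqP => [/setP/(_ i)|_]; last by rewrite mulr0.
by rewrite !inE eqxx.
Qed.

Lemma qgen_comm (i j : 'I_n) : (i < j)%N -> qgen j * qgen i = beta i j *: (qgen i * qgen j).
Proof.
move=> ij; have neij : i != j by rewrite -val_eqE ltn_eqF.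
rewrite !mul_delta ?disjoints1 ?inE // 1?eq_sym //.
rewrite /qcoef !big_set1 !big_mkcondr !big_set1 /= ij ltnNge (ltnW ij) /=.
by rewrite setUC scale1r.
Qed.

Lemma emonE X : emon X = [ffun Z : {set 'I_n} => (Z == X)%:R].
Proof.
pose P (s : seq 'I_n) := \prod_(i <- s) qgen i = [ffun Z : {set 'I_n} => (Z == [set i in s])%:R].
suff: P (enum X) by rewrite /P /emon => ->; rewrite set_enum.
have : sorted (fun i j : 'I_n => (i < j)%N) (enum X).
  rewrite /enum_mem -enumT; apply: sorted_filter.
    by move=> ? ? ?; apply: ltn_trans.
  by have := iota_ltn_sorted 0 n; rewrite -val_enum_ord sorted_map.
elim: (enum X) => [_|i s IHs].
  by rewrite /P big_nil; apply/ffunP => Z; rewrite !ffunE; congr (_ == _)%:R;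
     apply/setP => j; rewrite !inE.
rewrite /= (path_sortedE (fun _ _ _ => @ltn_trans _ _ _)) => /andP[/allP lt_is srt].
rewrite /P big_cons IHs // mul_delta; last first.
  rewrite disjoints1 inE; apply/negP => /lt_is; by rewrite ltnn.
rewrite {1}/qcoef big_set1 big1 ?scale1r => [|j]; last first.
  by rewrite inE => /andP[/lt_is/ltnW ij]; rewrite ltnNge ij.
by apply/ffunP => Z; rewrite !ffunE; congr (_ == _)%:R; apply/setP => j; rewrite !inE.
Qed.

Lemma qext_sum f : f = \sum_X f X *: emon X.
Proof.
apply/ffunP => Z; rewrite sum_ffunE (bigD1 Z) //= emonE !ffunE eqxx.
rewrite big1 ?addr0 => [|X /negbTE neX]; first by rewrite [RHS]mulr1.
by rewrite emonE !ffunE eq_sym neX [LHS]mulr0.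
Qed.

Lemma emon_basis : basis_of fullv [seq emon X | X : {set 'I_n}].
Proof.
have sE : <<[seq emon X | X : {set 'I_n}]>>%VS = fullv.
  apply/eqP; rewrite eqEsubv subvf; apply/subvP => f _; rewrite (qext_sum f).
  by apply: memv_suml => X _; apply/memvZ/memv_span/map_f; rewrite mem_enum.
by rewrite basisEdim sE subvv /= size_map -cardT dimvf /dim /= muln1.
Qed.

Lemma emonM X Y : emon X * emon Y =
  if [disjoint X & Y] then qcoef X Y *: emon (X :|: Y) else 0.
Proof.
rewrite !emonE; case: ifPn => [/mul_delta //|ndXY].
apply/ffunP => Z; rewrite !ffunE /= big1 // => W sWZ; rewrite !ffunE.
case: eqP => [->|_]; last by rewrite mulr0 mul0r.
case: eqP => [eY|_]; last by rewrite mulr0.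
by case/negP: ndXY; rewrite -eY disjoint_sym disjoints_subset subsetDr.
Qed.

Lemma qgenE i : qgen i = emon [set i].
Proof. by rewrite emonE. Qed.

(* The subalgebra of E generated by the e_i with i in S.                       *)
Definition qext_on (S : {set 'I_n}) : {vspace E} :=
  agenv <<[seq qgen i | i in S]>>.

Lemma qext_onE S : qext_on S = <<[seq emon X | X in powerset S]>>%VS.
Proof.
apply/eqP; rewrite eqEsubv; apply/andP; split.
  apply: agenv_sub_modl.
    rewrite -memvE; have -> : 1 = emon set0 by rewrite /emon enum_set0 big_nil.
    by apply/memv_span/map_f; rewrite mem_enum inE sub0set.
  apply/prodvP => u v /coord_span -> /coord_span ->.
  rewrite big_distrl; apply: memv_suml => k _.
  rewrite big_distrr; apply: memv_suml => m _ /=.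
  rewrite -scalerAl -scalerAr; do 2!apply: memvZ.
  set u' := _`_k; set v' := _`_m.
  have : u' \in [seq qgen i | i in S] by rewrite mem_nth ?size_image.
  have : v' \in [seq emon X | X in powerset S] by rewrite mem_nth ?size_image.
  case/mapP => X; rewrite mem_enum inE => sXS -> /mapP[i].
  rewrite mem_enum => iS ->; rewrite qgenE emonM; case: ifP => _; last exact: mem0v.
  by apply/memvZ/memv_span/map_f; rewrite mem_enum inE subUset sub1set iS.
apply/span_subvP => _ /mapP[X + ->]; rewrite mem_enum inE => /subsetP sXS.
rewrite /emon big_seq; elim/big_ind: _ => [|u v|i].
- by rewrite memvE sub1_agenv.
- by move=> uS vS; rewrite -[qext_on S]agenvM memv_mul.
rewrite mem_enum => /sXS iS; apply: (subvP (sub_agenv _)).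
by apply/memv_span/map_f; rewrite mem_enum.
Qed.

End QExt.

(* The quotient W / U of subspaces U <= W, modelled on the complement W :\: U  *)
(* of U in W; the class of v is its projection along U.                        *)

Section Quotient.
Variables (K : fieldType) (vT : vectType K) (W U : {vspace vT}).

Definition quotv : vectType K := subvs_of (W :\: U)%VS.

Definition quot_class : 'Hom(vT, quotv) :=
  (linfun (vsproj (W :\: U)%VS) \o addv_pi1 W U)%VF.

Definition quot_repr : 'Hom(quotv, vT) := linfun (@vsval _ _ (W :\: U)%VS).

Lemma quot_repr_mem a : quot_repr a \in W.
Proof. by rewrite lfunE; apply: (subvP (diffvSl W U)); apply: subvsP. Qed.

Lemma quot_classK a : quot_class (quot_repr a) = a.
Proof.
rewrite lfunE /= lfunE /= lfunE /= /addv_pi1 daddv_pi_id ?capv_diff ?subvsP //.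
exact: vsvalK.
Qed.

Lemma quot_class_eq0 v : v \in W -> (quot_class v == 0) = (v \in U).
Proof.
move=> Wv; rewrite lfunE /= lfunE /=.
have piW : addv_pi1 W U v \in (W :\: U)%VS by apply: memv_pi.
have eqv : addv_pi1 W U v + addv_pi2 W U v = v.
  by apply: addv_pi1_pi2; apply: (subvP (addvSl W U)).
apply/eqP/idP => [/(congr1 vsval)|Uv].
  by rewrite vsprojK //= => p0; rewrite -eqv p0 add0r memv_pi2.
apply: val_inj; rewrite /= vsprojK //.
by apply: (addIr (addv_pi2 W U v)); rewrite eqv add0r addv_pi2_id.
Qed.

End Quotient.

Section ChiAlgebra.
Variables (K : fieldType) (n : nat) (beta : 'I_n -> 'I_n -> K).
Local Notation E := (qext beta).
Implicit Types (M : matroid 'I_n) (chi : {set 'I_n} -> K).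
Implicit Types (X I U C : {set 'I_n}) (x y : 'I_n) (s : seq 'I_n).

(* k : 'I_#|X| counts from 0, whence the sign (-1)^(k+1).                      *)
Definition bd chi X : E :=
  \sum_(k < #|X|) (-1) ^+ k.+1 *:
     (chi (X :\ enum_val k) *: emon beta (X :\ enum_val k)).

(* The right ideal of the algebra generated by the e_i, i in ground M.         *)
Definition chi_ideal M chi : {vspace E} :=
  (<<[seq bd chi C | C in [pred C | circuit M C && (1 < #|C|)%N]]
     ++ [seq qgen beta i | i in [pred i | loop M i]]>>
   * qext_on beta (ground M))%VS.

Definition is_chi_algebra M chi : Prop :=
  (forall I, I \subset ground M -> (chi I != 0) = (I \in indep M)) /\
  (forall U U', unidependent M U -> unidependent M U' -> U' \subset U ->
     exists2 eps : K, eps != 0 &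
       bd chi U = eps *: (bd chi U' * emon beta (U :\: U'))).

Definition chi_alg M chi : vectType K :=
  quotv (qext_on beta (ground M)) (chi_ideal M chi).

(* The class [X] of e_X.                                                       *)
Definition class_of M chi X : chi_alg M chi :=
  quot_class (qext_on beta (ground M)) (chi_ideal M chi) (emon beta X).

(* The image of the span of the monomials of degree l.                         *)
Definition chi_alg_deg M chi (l : nat) : {vspace chi_alg M chi} :=
  <<[seq class_of M chi X | X in [pred X : {set 'I_n} |
                                    (X \subset ground M) && (#|X| == l)]]>>%VS.

(* The value p_x(e_I) for I independent; the y in I parallel to x is unique.   *)
Definition contr_mon M chi x I : E :=
  if x \in I then emon beta (I :\ x)
  else if [pick y in I | parallel M x y] is Some y then
    (chi_ext chi (rcons (enum (I :\ y)) x) /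
     chi_ext chi (rcons (enum (I :\ y)) y)) *: emon beta (I :\ y)
  else 0.

Definition contr_lift M chi x (f : E) : E :=
  \sum_(I in indep M) f I *: contr_mon M chi x I.

Fact contr_lift_is_linear M chi x : linear (contr_lift M chi x).
Proof.
move=> a f g; rewrite /contr_lift scaler_sumr -big_split /=.
by apply: eq_bigr => I _; rewrite !ffunE scalerDl scalerA.
Qed.
HB.instance Definition _ M chi x := GRing.isSemilinear.Build K E E _
  (contr_lift M chi x) (GRing.semilinear_linear (@contr_lift_is_linear M chi x)).

Lemma contr_lift_emon M chi x I :
  contr_lift M chi x (emon beta I) =
  if I \in indep M then contr_mon M chi x I else 0.
Proof.
rewrite /contr_lift emonE; case: ifPn => [iI|niI].
  rewrite (bigD1 I) //= ffunE eqxx scale1r big1 ?addr0 // => J /andP[_ /negbTE neJ].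
  by rewrite ffunE neJ scale0r.
rewrite big1 // => J iJ; rewrite ffunE; case: eqP => [eJ|]; last by rewrite scale0r.
by rewrite -eJ iJ in niI.
Qed.

(* p_x : A(M) -> A(M/x), the linear map induced on the quotients by e_I |->    *)
(* contr_mon x I (I independent), e_X |-> 0 (X dependent). When A(M) is a      *)
(* chi-algebra and x is not a loop, contr_lift maps chi_ideal M chi into the   *)
(* ideal of M/x, so that the choice of representatives is immaterial.          *)
Definition proj M chi x :
    'Hom(chi_alg M chi, chi_alg (contract M x) (chi_contract chi x)) :=
  (quot_class (qext_on beta (ground (contract M x)))
              (chi_ideal (contract M x) (chi_contract chi x))
   \o linfun (contr_lift M chi x)
   \o quot_repr (qext_on beta (ground M)) (chi_ideal M chi))%VF.

(* Contractions by the successive elements of t, the head of t first.          *)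
Fixpoint contract_seq M (t : seq 'I_n) : matroid 'I_n :=
  if t is x :: t' then contract_seq (contract M x) t' else M.

Fixpoint chi_contract_seq chi (t : seq 'I_n) : {set 'I_n} -> K :=
  if t is x :: t' then chi_contract_seq (chi_contract chi x) t' else chi.

Fixpoint proj_seq (t : seq 'I_n) M chi :
    'Hom(chi_alg M chi, chi_alg (contract_seq M t) (chi_contract_seq chi t)) :=
  if t is x :: t' then
    (proj_seq t' (contract M x) (chi_contract chi x) \o proj M chi x)%VF
  else \1%VF.

(* p_(i_1) \o ... \o p_(i_l) for s = (i_1, ..., i_l): i_l is contracted first, *)
(* whence the rev. Degree l is mapped to the degree 0 part of A(M/I), which is *)
(* identified with K by taking the coordinate on the class of e_set0 = 1.      *)
Definition proj_form M chi s : 'Hom(chi_alg M chi, K^o) :=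
  let N := contract_seq M (rev s) in
  let chiN := chi_contract_seq chi (rev s) in
  (linfun (coord [tuple class_of N chiN set0] ord0 : chi_alg N chiN -> K^o)
   \o proj_seq (rev s) M chi)%VF.

(* The set {[X] : X in B}, without repetition.                                 *)
Definition classes_of M chi (B : {set {set 'I_n}}) : seq (chi_alg M chi) :=
  undup [seq class_of M chi X | X in B].

(* B is the family of independent sets whose classes form the candidate basis. *)
Definition diagonal_basis M chi (l : nat) (B : {set {set 'I_n}})
    (sigma : forall I : {set 'I_n}, 'S_#|I|) : Prop :=
  [/\ forall I, I \in B -> I \in indep M /\ #|I| = l,
      (\dim (chi_alg_deg M chi l) <= size (classes_of M chi B))%N
    & forall (I J : {set 'I_n}) (tau : 'S_#|J|), I \in B -> J \in B ->
        flag M (listing tau) = flag M (listing (sigma I)) -> J = I].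

End ChiAlgebra.

(* Main.v *)
Require Import Defs.
From HB Require Import structures.
From mathcomp Require Import all_boot all_order all_algebra all_fingroup all_field.
From mathcomp Require Import ring zify.

Set Implicit Arguments.
Unset Strict Implicit.
Unset Printing Implicit Defensive.

Import GRing.Theory.
Local Open Scope ring_scope.

(* Call x and y parallel also when x = y. Then p_x(e_I) is nonzero only if I
   contains an element y parallel to x, and in that case it is
   chi((I - y) * x) / chi((I - y) * y) times e_(I - y). Evaluating p_x on the
   boundary of a unidependent U gives 0 when U has no element parallel to x,
   the boundary of U - y in M / x (up to sign) when it has exactly one, y, and
   two cancelling terms when it has two, which then form the circuit of U; so
   p_x maps the ideal of M into that of M / x, which is again a chi-algebra.
   Iterating, p_(I^sigma)([J]) vanishes unless J can be listed so that its
   entries are successively parallel to those of I^sigma in the contractions,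
   and then the two listings have the same flag, which forces J = I. Conversely
   p_(I^sigma)([I]) = 1, so the functionals are dual to the classes, which are
   therefore free, and there are at least dim A_l of them. *)

(** * Ranks, circuits, unidependents and parallel elements of a matroid *)

Section Matroids.
Variables (T : finType) (M : matroid T).
Implicit Types (A C D I J U X : {set T}) (x y : T).

(** A largest independent [J] between [I] and [X] works: if it were smaller than a maximum
    independent subset [J0] of [X], exchange with [J0] would enlarge it. *)
Lemma indep_augment I X : I \in indep M -> I \subset X ->
  exists J, [/\ J \in indep M, I \subset J, J \subset X & #|J| = rank M X].
Proof.
move=> iI sIX.
have [J0 /andP[iJ0 sJ0] rJ0] :
    {J0 | J0 \in [pred J | (J \in indep M) && (J \subset X)] & rank M X = #|J0|}.
  by apply: eq_bigmax_cond; apply/card_gt0P; exists I; rewrite inE iI.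
pose Q := [pred J | [&& J \in indep M, I \subset J & J \subset X]].
have QI : Q I by rewrite /= iI subxx.
pose J := [arg max_(J > I | Q J) #|J|]; exists J.
rewrite /J; case: arg_maxnP => {J} // J /and3P[iJ sIJ sJX] maxJ; split=> //.
apply/eqP; rewrite eqn_leq {1}/rank leq_bigmax_cond ?iJ //= leqNgt rJ0.
apply/negP => /(indep_exchange iJ iJ0)[z]; rewrite inE => /andP[zJ zJ0] izJ.
have : (#|z |: J| <= #|J|)%N.
  apply: maxJ; rewrite /= izJ subUset sub1set (subsetP sJ0) //= sJX andbT.
  by rewrite subsetU // sIJ orbT.
by rewrite cardsU1 zJ ltnn.
Qed.

Lemma leq_card_rank I X : I \in indep M -> I \subset X -> (#|I| <= rank M X)%N.
Proof. by move=> iI sIX; rewrite /rank leq_bigmax_cond ?iI. Qed.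

Lemma rank_witness X : exists I, [/\ I \in indep M, I \subset X & #|I| = rank M X].
Proof.
by have [I [iI _ sIX cI]] := indep_augment (indep0 M) (sub0set X); exists I.
Qed.

Lemma circuitP C : reflect
  [/\ C \subset ground M, C \notin indep M & forall x, x \in C -> C :\ x \in indep M]
  (circuit M C).
Proof.
apply: (iffP minsetP) => [[/andP[sC dC] minC]|[sC dC minC]].
  split=> // x xC; apply/negPn/negP => dCx.
  have := minC (C :\ x); rewrite /= dCx (subset_trans (subsetDl _ _) sC) subsetDl.
  by move=> /(_ isT isT) eC; move: xC; rewrite -eC !inE eqxx.
split; first by rewrite /= sC.
move=> D /andP[_ dD] sDC; apply/eqP; rewrite eqEsubset sDC /=.
apply/subsetP => x xC; apply/negPn/negP => xD; case/negP: dD.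
by apply: indepS (minC x xC); rewrite subsetD1 sDC.
Qed.

Lemma dep_circuit X : X \subset ground M -> X \notin indep M ->
  exists2 C, circuit M C & C \subset X.
Proof.
move=> sX dX; have [|C mC sC] := @minset_exists _
  [pred X : {set T} | (X \subset ground M) && (X \notin indep M)] X.
  by rewrite /= sX.
by exists C.
Qed.

Lemma circuit_neq0 C : circuit M C -> exists x, x \in C.
Proof.
case/circuitP=> _ dC _; apply/set0Pn; apply: contraNneq dC => ->; exact: indep0.
Qed.

(** Working form of unidependence: inside [U], dependence is containment of the unique circuit, so
    that later independence claims reduce to inclusions. *)
Lemma unidependentP U : reflect
  (exists2 C, circuit M C & [/\ U \subset ground M, C \subset U &
     forall D, D \subset U -> (D \notin indep M) = (C \subset D)])
  (unidependent M U).
Proof.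
apply: (iffP andP) => [[sU /cards1P[C eC]]|[C cC [sU sCU UC]]].
  have /[!(inE, eqxx)] /andP[cC sCU] : C \in [set C : {set T} | circuit M C && (C \subset U)].
    by rewrite eC inE.
  exists C => //; split=> // D sDU; apply/idP/idP => [dD|sCD].
    have [C' cC' sC'] := dep_circuit (subset_trans sDU sU) dD.
    have : C' \in [set C : {set T} | circuit M C && (C \subset U)].
      by rewrite inE cC' (subset_trans sC').
    by rewrite eC inE => /eqP <-.
  by case/circuitP: cC => _ dC _; apply: contra dC; apply: indepS.
split=> //; apply/cards1P; exists C; apply/setP => D; rewrite !inE.
apply/andP/eqP => [[/circuitP[_ dD minD] sD]|->]; last by [].
apply/eqP; rewrite eq_sym eqEsubset -UC // dD /=.
apply/subsetP => x xD; apply: contraT => xC.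
have := minD x xD; apply: contraLR => _.
rewrite UC ?(subset_trans (subsetDl _ _)) //.
by rewrite subsetD1 xC -UC // dD.
Qed.

(** Suppose a dependent [D] misses some [z] of a circuit [C] in [U]. A maximal independent [J] in
    [U] extending [C :\ z] avoids [z] and has at least [#|U| - 1] elements, so [J = U :\ z]; but
    then [J] contains [D]. *)
Lemma unidependent_remove U c : U \subset ground M -> U \notin indep M ->
  c \in U -> U :\ c \in indep M -> unidependent M U.
Proof.
move=> sU dU cU iUc; apply/unidependentP.
have [C cC sCU] := dep_circuit sU dU; exists C => //; split=> // D sDU.
have /circuitP[_ dC minC] := cC.
apply/idP/idP => [dD|sCD]; last by apply: contra dC; apply: indepS.
apply/subsetP => z zC; apply: contraT => zD.
have [|J [iJ sJ sJU cJ]] := indep_augment (minC z zC) (X := U).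
  by rewrite (subset_trans (subsetDl _ _)).
have zJ : z \notin J.
  apply: contra dC => zJ; apply: indepS iJ; rewrite -(setD1K zC).
  by rewrite subUset sub1set zJ.
have leJ : (#|U :\ c| <= #|J|)%N by rewrite cJ leq_card_rank ?subsetDl.
have eJ : J = U :\ z.
  apply/eqP; rewrite eqEcard subsetD1 sJU zJ /=.
  move: leJ; have := cardsD1 c U; have := cardsD1 z U.
  by rewrite cU (subsetP sCU _ zC); lia.
by case/negP: dD; apply: indepS iJ; rewrite eJ subsetD1 sDU.
Qed.

(** Reflexive closure of [parallel]; it merges the two nonzero cases in the definition of p_x. *)
Definition par x y : bool := (x == y) || parallel M x y.

Lemma parxx x : par x x.
Proof. by rewrite /par eqxx. Qed.

Lemma par_sym x y : par x y = par y x.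
Proof. by rewrite /par /parallel eq_sym setUC. Qed.

(** Extend [[set y]] to a maximal independent [J] in [y |: (x |: A)]. It avoids [x] because
    [[set x; y]] is dependent, and its size then forces [J = y |: A]. *)
Lemma parallel_swap x y A : parallel M x y -> x \notin A ->
  x |: A \in indep M -> y |: A \in indep M.
Proof.
case/andP=> nxy /circuitP[_ dxy minxy] xA ixA.
have iy : [set y] \in indep M.
  have -> : [set y] = [set x; y] :\ x by rewrite setU1K ?inE.
  by rewrite minxy // !inE eqxx.
have [|J [iJ]] := indep_augment iy (X := y |: (x |: A)); first by rewrite subsetUl.
rewrite sub1set => yJ sJ cJ.
have xJ : x \notin J.
  by apply: contra dxy => xJ; apply: indepS iJ; rewrite subUset !sub1set xJ.
have sJA : J \subset y |: A.
  apply/subsetP => z zJ; move/subsetP: sJ => /(_ z zJ); rewrite !inE.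
  by case: (z =P x) zJ => [->|//]; rewrite (negbTE xJ).
have : (#|x |: A| <= #|J|)%N by rewrite cJ leq_card_rank // subsetUr.
rewrite cardsU1 xA => leJ; have <- // : J = y |: A.
apply/eqP; rewrite eqEcard sJA cardsU1; case: (y \in A) => //=.
exact: leq_trans leJ.
Qed.

Lemma par_swap x y A : par x y -> x \notin A ->
  x |: A \in indep M -> y |: A \in indep M.
Proof. by case/predU1P=> [->//|]; apply: parallel_swap. Qed.

Lemma dep_par x y : [set x] \in indep M -> [set y] \in indep M ->
  [set x; y] \notin indep M -> par x y.
Proof.
move=> ix iy dxy; rewrite /par; case: eqVneq => //= nxy; rewrite /parallel nxy.
apply/circuitP; split=> //.
  by rewrite subUset; apply/andP; split; apply: (@indep_ground _ M).
move=> z; rewrite !inE => /orP[] /eqP->; first by rewrite setU1K ?inE.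
by rewrite setUC setU1K // inE eq_sym.
Qed.

(** If [y] and [y'] were distinct, swapping [y] for [x] in the independent pair they form would make
    [x] and [y'] independent. *)
Lemma par_indep_eq x y y' J : J \in indep M -> [set x] \in indep M ->
  y \in J -> y' \in J -> par x y -> par x y' -> y = y'.
Proof.
move=> iJ ix yJ y'J pxy pxy'; apply/eqP/negPn/negP => nyy'.
have iyy : y |: [set y'] \in indep M.
  by apply: indepS iJ; rewrite subUset !sub1set yJ.
rewrite par_sym in pxy; have := par_swap pxy _ iyy; rewrite inE nyy' => /(_ isT).
case/predU1P: pxy' => [exy'|/andP[_ /circuitP[_ /negP d _]] //].
case/predU1P: pxy nyy' => [->|/andP[_ /circuitP[_ d _]]]; first by rewrite exy' eqxx.
by rewrite -exy' in iyy; rewrite iyy in d.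
Qed.

(** A maximum independent subset of [x |: A] keeps its size when [x] is swapped for [y]. *)
Lemma rank_par_le x y A : par x y -> (rank M (x |: A) <= rank M (y |: A))%N.
Proof.
case/predU1P=> [->//|pxy]; have [I [iI sI <-]] := rank_witness (x |: A).
case: (boolP (x \in I)) => xI; last first.
  apply: leq_card_rank => //; apply/subsetP => z zI.
  move/subsetP: sI => /(_ z zI); rewrite !inE.
  by case: (z =P x) zI => [->|//= _ _ ->]; rewrite ?orbT // (negbTE xI).
have ix : x \notin I :\ x by rewrite !inE eqxx.
have iy : y |: (I :\ x) \in indep M by apply: (parallel_swap pxy); rewrite ?setD1K.
have yI : y \notin I :\ x.
  case/andP: pxy => nxy /circuitP[_ d _]; apply: contra d.
  rewrite inE => /andP[_ yI]; apply: indepS iI; by rewrite subUset !sub1set xI.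
rewrite (cardsD1 x) xI -[X in (X <= _)%N]/(true + _)%N -[true]/(~~ false) -(negbTE yI) -cardsU1.
apply: leq_card_rank => //; rewrite subUset sub1set !inE eqxx /=.
apply/subsetP => z; rewrite !inE => /andP[nzx zI].
by move/subsetP: sI => /(_ z zI); rewrite !inE (negbTE nzx) /= => ->; rewrite orbT.
Qed.

Lemma cl_par x y A : par x y -> cl M (x |: A) = cl M (y |: A).
Proof.
move=> pxy; have rk X : rank M (x |: X) = rank M (y |: X).
  by apply/eqP; rewrite eqn_leq !rank_par_le // par_sym.
by apply/setP => z; rewrite !inE rk setUCA rk setUCA.
Qed.

End Matroids.

(** * Contraction by a non-loop: rank, closure, unidependents *)

Section Contraction.
Variables (T : finType) (M : matroid T) (x : T).
Hypothesis ix : [set x] \in indep M.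
Implicit Types (C D I U S : {set T}) (y : T).

Lemma nonloop_ground : x \in ground M.
Proof. by rewrite -sub1set; apply: (@indep_ground _ M). Qed.

Lemma contract_indepE I : I \subset ground M :\ x ->
  (I \in indep (contract M x)) = (x |: I \in indep M).
Proof. by move=> sI; rewrite inE sI ix. Qed.

Lemma contract_indepP I :
  (I \in indep (contract M x)) = (x \notin I) && (x |: I \in indep M).
Proof.
rewrite inE ix subsetD1 -andbA; case: (boolP (x |: I \in indep M)) => [|_]; last by rewrite !andbF.
by move/(@indep_ground _ M); rewrite subUset !andbT => /andP[_ ->].
Qed.

Lemma rank_contract S : x \notin S -> rank M (x |: S) = (rank (contract M x) S).+1.
Proof.
move=> xS; apply/eqP; rewrite eqn_leq; apply/andP; split.
  have [|J [iJ]] := indep_augment ix (X := x |: S); first exact: subsetUl.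
  rewrite sub1set => xJ sJ <-; rewrite (cardsD1 x) xJ ltnS; apply: leq_card_rank.
    by rewrite contract_indepP !inE eqxx setD1K.
  apply/subsetP => z; rewrite !inE => /andP[nzx zJ].
  by move/subsetP: sJ => /(_ z zJ); rewrite !inE (negbTE nzx).
have [I [iI sI <-]] := rank_witness (contract M x) S.
have := iI; rewrite contract_indepP => /andP[xI ixI].
have -> : #|I|.+1 = #|x |: I| by rewrite cardsU1 xI.
by rewrite leq_card_rank // setUS.
Qed.

Lemma cl_contract S : x \notin S -> cl M (x |: S) = x |: cl (contract M x) S.
Proof.
move=> xS; apply/setP => z; rewrite !inE.
case: (eqVneq z x) => [->|nzx] /=.
  by rewrite setUA setUid eqxx andbT nonloop_ground.
have xzS : x \notin z |: S by rewrite !inE eq_sym (negbTE nzx).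
by rewrite setUCA !rank_contract // eqSS.
Qed.

Lemma par_contract_indep y J : J \in indep M -> y \in J -> par M x y ->
  J :\ y \in indep (contract M x).
Proof.
move=> iJ yJ pxy; rewrite contract_indepP.
have ixJ : x |: (J :\ y) \in indep M.
  by rewrite par_sym in pxy; apply: (par_swap pxy); rewrite ?setD1K // !inE eqxx.
rewrite ixJ andbT !inE negb_and negbK; case: (eqVneq x y) => //= nxy.
apply/negP => xJ; case/predU1P: pxy => [exy|/andP[_ /circuitP[_ d _]]].
  by rewrite exy eqxx in nxy.
by case/negP: d; apply: indepS iJ; rewrite subUset !sub1set xJ.
Qed.

(** Lets (UC2) be read off in [M] for unidependents of [M / x]. Deleting an element [c] of the
    circuit of [U] leaves a set independent in [M / x], hence independent in [M] together with
    [x]. *)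
Lemma unidependent_contract U : unidependent (contract M x) U ->
  unidependent M (x |: U).
Proof.
case/unidependentP=> C cC [sU sCU UC].
have [c cCc] := circuit_neq0 cC.
have sU' : U \subset ground M :\ x := sU.
have xU : x \notin U by move: sU'; rewrite subsetD1 => /andP[].
have cU := subsetP sCU _ cCc.
apply: (@unidependent_remove _ _ _ c).
- by rewrite subUset sub1set nonloop_ground; move: sU'; rewrite subsetD1 => /andP[].
- by rewrite -contract_indepE // UC.
- by rewrite !inE cU orbT.
have : U :\ c \in indep (contract M x).
  by rewrite -[_ \in _]negbK UC ?subsetDl // subsetD1 cCc andbF.
rewrite contract_indepP => /andP[_].
have -> // : (x |: U) :\ c = x |: U :\ c.
apply/setP=> z; rewrite !inE; case: (eqVneq z x) => //= ->; rewrite andbT.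
by apply: contraNneq xU => ->.
Qed.

(* Since x and y span the same flat, D + x and D + y are simultaneously
   dependent, so the circuits of M / x inside U - y only see C. *)
Lemma contract_par_circuit y U C : y \in U -> par M x y ->
    circuit M C -> U \subset ground M -> C \subset U ->
    (forall D, D \subset U -> (D \notin indep M) = (C \subset D)) ->
    (forall z, z \in U -> par M x z -> z = y) ->
  [/\ circuit (contract M x) (C :\ y), U :\ y \subset ground (contract M x) &
   forall D, D \subset U :\ y ->
     (D \notin indep (contract M x)) = (C :\ y \subset D)].
Proof.
move=> yU pxy cC sU sCU UC uniqy.
have xUy : x \notin U :\ y.
  rewrite !inE; case: (boolP (x \in U)) => [xU|]; last by rewrite andbF.
  by rewrite andbT negbK; apply/eqP/uniqy/parxx.
have sUy : U :\ y \subset ground (contract M x).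
  by rewrite subsetD1 xUy andbT (subset_trans (subsetDl _ _)).
have UyC D : D \subset U :\ y ->
    (D \notin indep (contract M x)) = (C :\ y \subset D).
  move=> sD; rewrite contract_indepP.
  have xD : x \notin D by apply: contra xUy; apply: (subsetP sD).
  move: (sD); rewrite subsetD1 => /andP[sDU yD].
  rewrite xD /=; have -> : (x |: D \notin indep M) = (y |: D \notin indep M).
    by congr (~~ _); apply/idP/idP; apply: par_swap => //; rewrite par_sym.
  rewrite UC; last by rewrite subUset sub1set yU.
  by rewrite subDset.
split=> //; apply/circuitP.
have sCy : C :\ y \subset U :\ y by rewrite setSD.
split=> [||z zC]; first exact: subset_trans sUy.
  by rewrite UyC.
rewrite -[_ \in _]negbK UyC; last exact: subset_trans (subsetDl _ _) sCy.
by rewrite subsetD1 zC andbF.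
Qed.

End Contraction.

(** * Signs of listings *)

Section Signs.
Variable n : nat.
Implicit Types (X Y J : {set 'I_n}) (x y i : 'I_n) (s : seq 'I_n).

(** The number of transpositions that carry [x] to the end of the increasing listing of [X].
    Counting from the end suits [chi_contract], which appends [x] last. *)
Definition nabove X x : nat := #|[set j in X | (x < j)%N]|.

Lemma enum_ord_sorted X : sorted (fun i j : 'I_n => (i < j)%N) (enum X).
Proof.
rewrite /enum_mem -enumT; apply: sorted_filter; first by move=> ? ? ?; apply: ltn_trans.
by have := iota_ltn_sorted 0 n; rewrite -val_enum_ord sorted_map.
Qed.

Lemma enum_split X x : x \in X -> exists s1 s2,
  [/\ enum X = s1 ++ x :: s2, enum (X :\ x) = s1 ++ s2 & size s2 = nabove X x].
Proof.
rewrite -mem_enum => xX.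
have [s1 [s2 eX]] : exists s1 s2, enum X = s1 ++ x :: s2.
  by case/splitPr: xX => s1 s2; exists s1, s2.
exists s1, s2; move: (enum_ord_sorted X).
rewrite (sorted_pairwise (fun _ _ _ => @ltn_trans _ _ _)) eX pairwise_cat /=.
case/and4P => /allrelP lt1 _ /allP lt2 _.
have {}lt1 j : j \in s1 -> (j < x)%N by move=> /lt1; apply; rewrite inE eqxx.
split=> //.
  have -> : enum (X :\ x) = [seq j <- enum X | j != x].
    rewrite /enum_mem -filter_predI; apply: eq_filter => j.
    by rewrite /= !inE.
  rewrite eX filter_cat /= eqxx; congr (_ ++ _); apply/all_filterP/allP => j.
    by move/lt1; apply: contraTneq => ->; rewrite ltnn.
  by move/lt2; apply: contraTneq => ->; rewrite ltnn.
have -> : nabove X x = size [seq j : 'I_n <- enum X | (x < j)%N].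
  rewrite /nabove cardE; congr size.
  rewrite /enum_mem -filter_predI; apply: eq_filter => j.
  by rewrite /= !inE andbC.
rewrite eX filter_cat /= ltnn size_cat (eq_in_filter (a2 := pred0)) => [|j /lt1].
  by rewrite filter_pred0 (all_filterP _) //; apply/allP => j /lt2.
by move=> /ltnW; rewrite leqNgt => /negbTE.
Qed.

Lemma nabove_remove X x y : y \in X ->
  nabove X x = ((x < y) + nabove (X :\ y) x)%N.
Proof.
move=> yX; rewrite /nabove (cardsD1 y) !inE yX; congr (_ + _)%N.
by apply: eq_card => j; rewrite !inE andbA.
Qed.

Lemma nabove_removexx X x : nabove (X :\ x) x = nabove X x.
Proof.
by apply: eq_card => j; rewrite !inE; case: eqP => //= ->; rewrite ltnn andbF.
Qed.

Lemma setD1AC X x y : X :\ x :\ y = X :\ y :\ x.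
Proof. by rewrite !setDDl setUC. Qed.

(** Moving [x] and then [y] to the end of the remaining listing, or [y] and then [x], gives two
    listings of [X] that differ by one transposition. *)
Lemma odd_nabove_swap X x y : x \in X -> y \in X -> x != y ->
  odd (nabove X x + nabove (X :\ x :\ y) y)
  = ~~ odd (nabove X y + nabove (X :\ x :\ y) x).
Proof.
move=> xX yX nxy; rewrite nabove_removexx setD1AC nabove_removexx.
rewrite (nabove_remove x yX) (nabove_remove y xX).
by move: nxy; rewrite -val_eqE; case: (ltngtP x y) => //= _ _; lia.
Qed.

(** The cycle that takes the entry at position [j] to the last place and keeps the order of the
    others; it is a product of [p.-1 - j] adjacent transpositions. *)
Lemma perm_last_to p (j : 'I_p) : exists2 sg : 'S_p,
  odd_perm sg = odd (p.-1 - j) &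
  forall k : 'I_p, sg k = (if (k == p.-1 :> nat) then j : nat else bump j k) :> nat.
Proof.
case: p j => [[]//|p] j; exists (lift_perm ord_max j 1).
  by rewrite odd_lift_perm odd_perm1 addbF /=; have := ltn_ord j; lia.
move=> k; case: (unliftP ord_max k) => [k' ->|->].
  have lt_k : (k' < p)%N := ltn_ord k'.
  rewrite lift_perm_lift perm1 /= [bump p k']/bump leqNgt lt_k add0n.
  by rewrite ltn_eqF.
by rewrite lift_perm_id eqxx.
Qed.

Lemma nth_listing x0 X (sg : 'S_#|X|) (k : 'I_#|X|) :
  nth x0 (listing sg) k = nth x0 (enum X) (sg k).
Proof.
by rewrite /listing (nth_map k) ?size_enum_ord // nth_ord_enum (enum_val_nth x0).
Qed.

Lemma size_listing X (sg : 'S_#|X|) : size (listing sg) = #|X|.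
Proof. by rewrite size_map size_enum_ord. Qed.

Lemma listing_uniq X (sg : 'S_#|X|) : uniq (listing sg).
Proof.
by rewrite map_inj_uniq ?enum_uniq // => k k' /enum_val_inj/perm_inj.
Qed.

Lemma listing_surj J s : uniq s -> [set i in s] = J ->
  exists tau : 'S_#|J|, listing tau = s.
Proof.
move=> us eJ; have szs : size s = #|J|.
  by rewrite -eJ cardsE; apply/esym/card_uniqP.
have sJ (k : 'I_#|J|) : nth (enum_val k) s k \in J.
  suff: nth (enum_val k) s k \in [set i in s] by rewrite eJ.
  by rewrite inE mem_nth // szs ltn_ord.
pose f (k : 'I_#|J|) := enum_rank_in (enum_valP k) (nth (enum_val k) s k).
have fE k : enum_val (f k) = nth (enum_val k) s k by rewrite enum_rankK_in.
have injf : injective f.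
  move=> k k' /(congr1 enum_val); rewrite !fE (set_nth_default (enum_val k)) ?szs //.
  by move/eqP; rewrite nth_uniq ?szs // => /eqP/val_inj.
exists (perm injf); case: (posnP #|J|) => [J0|Jgt0].
  by rewrite [s]size0nil ?szs //; apply: size0nil; rewrite size_listing.
pose x0 := enum_val (Ordinal Jgt0); apply: (@eq_from_nth _ x0).
  by rewrite size_listing szs.
move=> k; rewrite size_listing => kJ; rewrite (nth_listing x0 _ (Ordinal kJ)).
rewrite -enum_val_nth permE fE; apply: set_nth_default; by rewrite szs.
Qed.

(** The listing on the left arises from the increasing one of [x |: X] by moving [x] to the end,
    past the [nabove X x] larger elements. *)
Lemma chi_ext_rcons (K : fieldType) (chi : {set 'I_n} -> K) X x : x \notin X ->
  chi_ext chi (rcons (enum X) x) = (-1) ^+ nabove X x * chi (x |: X).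
Proof.
move=> xX; set Y := x |: X.
have xY : x \in Y by rewrite !inE eqxx.
have eYx : Y :\ x = X by rewrite setU1K.
have [s1 [s2 [eY]]] := enum_split xY; rewrite eYx => eX.
rewrite (nabove_remove x xY) ltnn eYx add0n => sz2.
have szY : #|Y| = (size s1 + size s2).+1 by rewrite cardE eY size_cat /= addnS.
have lt1 : (size s1 < #|Y|)%N by rewrite szY ltnS leq_addr.
have [sg sgn sgE] := perm_last_to (Ordinal lt1).
have <- : listing sg = rcons (enum X) x.
  apply: (@eq_from_nth _ x); first by rewrite size_listing size_rcons -cardE cardsU1 xX.
  move=> k; rewrite size_listing => kY; rewrite (nth_listing x _ (Ordinal kY)) sgE /=.
  rewrite nth_rcons eX eY szY /= size_cat /bump !nth_cat.
  case: eqP => [->|nk]; first by rewrite ltnn ltnn subnn.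
  rewrite szY in kY; case: (leqP (size s1) k) => [le1|lt_k].
    rewrite !add1n ltnNge (leq_trans le1) //= subSn //=.
    by rewrite ifT //; lia.
  by rewrite add0n lt_k ifT //; lia.
rewrite chi_ext_listing sgn /= szY /= addKn sz2.
by rewrite signr_odd.
Qed.

End Signs.

(** * The boundary operator, and the chi-algebra structure of a contraction *)

Section Boundary.
Variables (K : fieldType) (n : nat) (beta : 'I_n -> 'I_n -> K).
Local Notation E := (qext beta).
Local Notation e := (emon beta).
Implicit Types (chi : {set 'I_n} -> K) (X Y Z U : {set 'I_n}) (x y i : 'I_n).

Lemma sign_nabove_swap X x y : x \in X -> y \in X -> x != y ->
  (-1) ^+ nabove X x * (-1) ^+ nabove (X :\ x :\ y) y
  = - ((-1) ^+ nabove X y * (-1) ^+ nabove (X :\ y) x) :> K.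
Proof.
move=> xX yX nxy; rewrite -!exprD -signr_odd odd_nabove_swap // signrN signr_odd.
by rewrite setD1AC nabove_removexx.
Qed.

Lemma nabove_enum_val X (k : 'I_#|X|) : (nabove X (enum_val k) + k.+1 = #|X|)%N.
Proof.
have [s1 [s2 [eX _ <-]]] := enum_split (enum_valP k).
have ik : size s1 = k.
  have : index (enum_val k) (enum X) = k.
    by rewrite (enum_val_nth (enum_val k)) index_uniq ?enum_uniq // -cardE.
  have := enum_uniq X; rewrite eX cat_uniq /= negb_or index_cat.
  by case/and3P => _ /andP[/negbTE -> _] _; rewrite /= eqxx addn0.
have cX : #|X| = size (s1 ++ enum_val k :: s2) by rewrite -eX cardE.
by rewrite [RHS]cX size_cat /= ik addnC addSnnS.
Qed.

(** Since position and number of larger elements add up to [#|X|], the sign can be counted from the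
    end at the cost of a global factor. *)
Lemma bdE chi X : bd beta chi X = (-1) ^+ #|X| *:
  \sum_(i in X) ((-1) ^+ nabove X i * chi (X :\ i)) *: e (X :\ i).
Proof.
rewrite /bd [in RHS]big_enum_val scaler_sumr; apply: eq_bigr => k _.
rewrite !scalerA mulrA -exprD -{2}(nabove_enum_val k); congr (_ * _ *: _).
by rewrite addnAC addnn [in RHS]exprD -[_ ^+ _.*2]signr_odd odd_double mul1r.
Qed.

(** The linear map that erases [x] from the monomials containing it and kills the others, with no
    sign or factor. It carries identities for [x |: U] in [M] to identities for [U] in [M / x]. *)
Definition strip x (f : E) : E :=
  [ffun Z : {set 'I_n} => if x \in Z then 0 else f (x |: Z)].

Fact strip_is_linear x : linear (strip x).
Proof.
move=> a f g; apply/ffunP => Z; rewrite !ffunE.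
by case: ifP => _; rewrite ?scaler0 ?addr0.
Qed.
HB.instance Definition _ x := GRing.isSemilinear.Build K E E _
  (strip x) (GRing.semilinear_linear (strip_is_linear x)).

Lemma strip_emon x X : strip x (e X) = if x \in X then e (X :\ x) else 0.
Proof.
apply/ffunP => Z; case: ifP => xX; rewrite !emonE !ffunE; last first.
  case: ifP => // _; case: eqP => // eX.
  by rewrite -eX !inE eqxx in xX.
case: ifP => xZ; first by case: eqP => // eZ; rewrite eZ !inE eqxx in xZ.
congr (nat_of_bool _)%:R; apply/eqP/eqP => [<-|->]; last by rewrite setD1K.
by rewrite setU1K // xZ.
Qed.

(** Only the factor contributed by [x] against [Y] is lost with [x], and it is the same for every
    monomial of [f]. *)
Lemma strip_mul_emon x f Y : x \notin Y ->
  strip x (f * e Y) = qcoef beta [set x] Y *: (strip x f * e Y).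
Proof.
move=> xY; rewrite (qext_sum f) big_distrl !linear_sum big_distrl scaler_sumr /=.
apply: eq_bigr => X _; rewrite -scalerAl !linearZ /= -scalerAl scalerA mulrC -scalerA.
congr (_ *: _); rewrite emonM strip_emon.
case: (boolP (x \in X)) => xX; last first.
  rewrite mul0r scaler0; case: ifP => _; last by rewrite linear0.
  by rewrite linearZ /= strip_emon !inE (negbTE xX) (negbTE xY) scaler0.
have dXx : [disjoint [set x] & X :\ x] by rewrite disjoints1 !inE eqxx.
have -> : [disjoint X & Y] = [disjoint X :\ x & Y].
  by rewrite !disjoints_subset -{1}(setD1K xX) subUset sub1set inE xY.
rewrite emonM; case: ifP => _; last by rewrite linear0 scaler0.
rewrite linearZ /= strip_emon !inE xX /= -{1}(setD1K xX) qcoefUl // -scalerA.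
congr (_ *: (_ *: e _)); rewrite setDUl; congr (_ :|: _).
by apply/setDidPl; rewrite disjoint_sym disjoints1.
Qed.

Lemma chi_contractE chi x X : x \notin X ->
  chi_contract chi x X = (-1) ^+ nabove X x * chi (x |: X).
Proof. exact: chi_ext_rcons. Qed.

(** The term of the boundary that omits [x] is killed; the others are compared one by one. *)
Lemma strip_bd chi x U : x \notin U ->
  strip x (bd beta chi (x |: U)) = (-1) ^+ nabove U x *: bd beta (chi_contract chi x) U.
Proof.
move=> xU; rewrite !bdE linearZ /= linear_sum cardsU1 xU.
rewrite (bigD1 x) ?inE ?eqxx //= setU1K // linearZ /= strip_emon (negbTE xU) scaler0 add0r.
rewrite (eq_bigl (fun i => i \in U)) => [|i]; last first.
  by rewrite !inE; case: eqP => [->|_]; rewrite ?andbT ?andbF //= (negbTE xU).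
rewrite scalerA !scaler_sumr; apply: eq_bigr => i iU.
have nix : i != x by apply: contraNneq xU => <-.
have Uxi : (x |: U) :\ i = x |: U :\ i.
  by apply/setP => z; rewrite !inE; case: (eqVneq z x) => //= ->; rewrite andbT eq_sym.
have xUi : x \notin U :\ i by rewrite !inE (negbTE xU) andbF.
rewrite linearZ /= strip_emon Uxi !inE eqxx /= setU1K // !scalerA; congr (_ *: _).
rewrite chi_contractE //.
(* Removing [i] and [x] in the two orders differs by a sign, which the extra element of [x |: U] in
   the global factor cancels. *)
have := @sign_nabove_swap (x |: U) i x; rewrite !inE iU eqxx orbT => /(_ isT isT nix).
rewrite -[nabove (x |: U) x]nabove_removexx Uxi !setU1K // => sw.
have {}sw : (-1) ^+ nabove (x |: U) i =
    - ((-1) ^+ nabove U x * (-1) ^+ nabove U i * (-1) ^+ nabove (U :\ i) x) :> K.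
  by rewrite -mulNr -sw -mulrA -signr_odd -expr2 sqrr_sign mulr1.
rewrite sw exprS.
by ring.
Qed.

Hypothesis beta_neq0 : forall i j : 'I_n, (i < j)%N -> beta i j != 0.

Lemma qcoef_neq0 X Y : qcoef beta X Y != 0.
Proof.
rewrite /qcoef; apply/prodf_neq0 => i _; apply/prodf_neq0 => j /andP[_].
exact: beta_neq0.
Qed.

(** (UC1) is a rewriting of [chi_contract]. For (UC2), apply [strip x] to the identity of [M] for
    [x |: U'] inside [x |: U]; the new constant stays nonzero because the [beta i j] are. *)
Lemma contract_chi_algebra (M : matroid 'I_n) chi x : [set x] \in indep M ->
  is_chi_algebra beta M chi ->
  is_chi_algebra beta (contract M x) (chi_contract chi x).
Proof.
move=> ix [UC1 UC2]; split=> [I sI|U U' uU uU' sU'].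
  have /andP[sIM xI] : (I \subset ground M) && (x \notin I) by rewrite -subsetD1.
  rewrite chi_contractE // mulf_eq0 signr_eq0 /= UC1 ?contract_indepE //.
  by rewrite subUset sub1set nonloop_ground.
have xU : x \notin U.
  by case/andP: uU => /= sU _; move: sU; rewrite subsetD1 => /andP[].
have xU' : x \notin U' by apply: contra xU; apply: (subsetP sU').
have [|eps eps0] := UC2 _ _ (unidependent_contract ix uU) (unidependent_contract ix uU').
  exact: setUS.
have -> : (x |: U) :\: (x |: U') = U :\: U'.
  apply/setP => z; rewrite !inE; case: (eqVneq z x) => //= ->.
  by rewrite (negbTE xU) andbF.
move/(congr1 (strip x)); rewrite linearZ /= strip_mul_emon; last by rewrite inE (negbTE xU) andbF.
rewrite !strip_bd // -scalerAl => /(congr1 ( *:%R ((-1) ^+ nabove U x))).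
rewrite !scalerA -expr2 sqrr_sign scale1r => ->; eexists; last by [].
by rewrite !mulf_neq0 ?signr_eq0 ?qcoef_neq0.
Qed.

End Boundary.

(** * The ideal of a chi-algebra and the values of p_x on monomials *)

Section Ideal.
Variables (K : fieldType) (n : nat) (beta : 'I_n -> 'I_n -> K).
Local Notation E := (qext beta).
Local Notation e := (emon beta).
Variables (M : matroid 'I_n) (chi : {set 'I_n} -> K).
Implicit Types (X Y Z U C D I J : {set 'I_n}) (x y i : 'I_n).

(** By bilinearity, as the algebra is spanned by the monomials. *)
Lemma chi_ideal_subP (V : {vspace E}) :
  (forall C X, circuit M C -> (1 < #|C|)%N -> X \subset ground M ->
     bd beta chi C * e X \in V) ->
  (forall i X, loop M i -> X \subset ground M -> qgen beta i * e X \in V) ->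
  (chi_ideal beta M chi <= V)%VS.
Proof.
move=> Vbd Vloop; apply/prodvP => u v /coord_span ->; rewrite qext_onE => /coord_span ->.
rewrite big_distrl; apply: memv_suml => k _.
rewrite big_distrr; apply: memv_suml => m _ /=.
rewrite -scalerAl -scalerAr; do 2!apply: memvZ.
set u' := _`_k; set v' := _`_m.
have : v' \in [seq e X | X in powerset (ground M)] by rewrite mem_nth ?size_image.
case/mapP => X; rewrite mem_enum inE => sX ->.
have : u' \in [seq bd beta chi C | C in [pred C | circuit M C && (1 < #|C|)%N]]
     ++ [seq qgen beta i | i in [pred i | loop M i]] 
  by rewrite mem_nth // size_cat !size_image.
rewrite mem_cat => /orP[] /mapP[y]; rewrite mem_enum inE.
  by case/andP=> cy gt1 ->; apply: Vbd.
by move=> ly ->; apply: Vloop.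
Qed.

Lemma emon_qext_on X : X \subset ground M -> e X \in qext_on beta (ground M).
Proof.
by move=> sX; rewrite qext_onE; apply/memv_span/map_f; rewrite mem_enum inE.
Qed.

Lemma qext_onM f g : f \in qext_on beta (ground M) ->
  g \in qext_on beta (ground M) -> f * g \in qext_on beta (ground M).
Proof. by move=> fS gS; rewrite -[qext_on _ _]agenvM memv_mul. Qed.

Lemma chi_ideal_sub_qext_on : (chi_ideal beta M chi <= qext_on beta (ground M))%VS.
Proof.
apply: chi_ideal_subP => [C X /circuitP[sC _ _] _ sX|i X /circuitP[si _ _] sX].
  apply: qext_onM; last exact: emon_qext_on.
  apply: memv_suml => k _; do 2!apply: memvZ; apply: emon_qext_on.
  exact: subset_trans (subsetDl _ _) sC.
by rewrite qgenE; apply: qext_onM; apply: emon_qext_on.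
Qed.

Definition coef Z (f : E) : K^o := f Z.

Fact coef_is_linear Z : linear (coef Z).
Proof. by move=> a f g; rewrite /coef !ffunE. Qed.
HB.instance Definition _ Z := GRing.isSemilinear.Build K E K^o _
  (coef Z) (GRing.semilinear_linear (coef_is_linear Z)).

(** No generator has a constant term, and right multiplication creates none. Hence the class of 1 is
    nonzero and is a legitimate coordinate vector for degree 0. *)
Lemma chi_ideal_coef0 f : f \in chi_ideal beta M chi -> f set0 = 0.
Proof.
have fg0 (g h : E) : g set0 = 0 -> coef set0 (g * h) = 0.
  move=> g0; rewrite /coef ffunE big1 // => X; rewrite subset0 => /eqP ->.
  by rewrite g0 mulr0 mul0r.
suff sub : (chi_ideal beta M chi <= lker (linfun (coef set0)))%VS.
  by move/(subvP sub); rewrite memv_ker lfunE => /eqP.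
apply: chi_ideal_subP => [C X _ gt1 _|i X _ _]; rewrite memv_ker lfunE /= fg0 //.
  rewrite /bd sum_ffunE big1 // => k _; rewrite !ffunE emonE ffunE.
  case: eqP => [/esym/eqP|_]; last by rewrite !scaler0.
  rewrite setD_eq0 => /subset_leq_card; rewrite cards1.
  by move=> /(leq_trans gt1); rewrite ltnn.
by rewrite ffunE; case: eqP => // /setP/(_ i); rewrite !inE eqxx.
Qed.

Lemma class_of_set0_neq0 : class_of beta M chi set0 != 0.
Proof.
rewrite quot_class_eq0; last exact/emon_qext_on/sub0set.
by apply/negP => /chi_ideal_coef0/eqP; rewrite emonE ffunE eqxx oner_eq0.
Qed.

Hypothesis chiM : is_chi_algebra beta M chi.

Lemma bd_unidependent_ideal U C : circuit M C -> (1 < #|C|)%N ->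
    U \subset ground M -> C \subset U ->
    (forall D, D \subset U -> (D \notin indep M) = (C \subset D)) ->
  bd beta chi U \in chi_ideal beta M chi.
Proof.
move=> cC gt1 sU sCU UC; have [_ UC2] := chiM.
have uU : unidependent M U by apply/unidependentP; exists C.
have uC : unidependent M C.
  apply/unidependentP; exists C => //; split=> //; first by case/circuitP: cC.
  by move=> D sD; apply: UC; apply: subset_trans sCU.
have [eps _ ->] := UC2 _ _ uU uC sCU; apply/memvZ/memv_mul.
  by apply: memv_span; rewrite mem_cat map_f // mem_enum inE cC.
by apply: emon_qext_on; apply: subset_trans (subsetDl _ _) sU.
Qed.

Variable x : 'I_n.
Hypothesis ix : [set x] \in indep M.

Lemma chi_contract_neq0 y I : y \notin I -> y |: I \in indep M ->
  chi_contract chi y I != 0.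
Proof.
move=> yI iyI; rewrite chi_contractE // mulf_neq0 ?signr_eq0 //.
by case: chiM => -> // ; apply: (@indep_ground _ M).
Qed.

(** One formula for both nonzero cases: if [x] is in [J], then [y = x] and the quotient is 1. *)
Lemma contr_lift_par y J : J \in indep M -> y \in J -> par M x y ->
  contr_lift M chi x (e J) =
  (chi_contract chi x (J :\ y) / chi_contract chi y (J :\ y)) *: e (J :\ y).
Proof.
move=> iJ yJ pxy; rewrite contr_lift_emon iJ /contr_mon.
case: (boolP (x \in J)) => xJ.
  rewrite (par_indep_eq iJ ix yJ xJ pxy (parxx _ _)) divff ?scale1r //.
  by rewrite chi_contract_neq0 ?setD1K // !inE eqxx.
case: pickP => [z /andP[zJ pxz]|/(_ y)].
  by rewrite (par_indep_eq iJ ix yJ zJ pxy) // /par pxz orbT.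
by move: pxy xJ; rewrite yJ => /predU1P[->|->] //; rewrite yJ.
Qed.

Lemma contr_lift_nopar J : (forall y, y \in J -> ~~ par M x y) ->
  contr_lift M chi x (e J) = 0.
Proof.
move=> np; rewrite contr_lift_emon /contr_mon; case: ifP => // _.
case: ifP => [/np|_]; first by rewrite parxx.
by case: pickP => // y /andP[/np]; rewrite /par negb_or => /andP[_ /negbTE ->].
Qed.

Lemma contr_lift_dep J : J \notin indep M -> contr_lift M chi x (e J) = 0.
Proof. by move=> dJ; rewrite contr_lift_emon (negbTE dJ). Qed.

End Ideal.

(** * The map p_x on ideals and on quotients *)

Lemma sub_quot_repr_mem (K : fieldType) (vT : vectType K) (W U : {vspace vT}) v :
  v \in W -> v - quot_repr W U (quot_class W U v) \in U.
Proof.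
move=> vW; rewrite -(quot_class_eq0 (W := W)); last by rewrite memvB ?quot_repr_mem.
by rewrite linearB /= quot_classK subrr.
Qed.

Section ContractIdeal.
Variables (K : fieldType) (n : nat) (beta : 'I_n -> 'I_n -> K).
Local Notation E := (qext beta).
Local Notation e := (emon beta).
Hypothesis beta_neq0 : forall i j : 'I_n, (i < j)%N -> beta i j != 0.
Variables (M : matroid 'I_n) (chi : {set 'I_n} -> K) (x : 'I_n).
Hypothesis chiM : is_chi_algebra beta M chi.
Hypothesis ix : [set x] \in indep M.
Implicit Types (X Y Z U C D I J : {set 'I_n}) (y i : 'I_n).
Local Notation N := (contract M x).
Local Notation chiN := (chi_contract chi x).
Local Notation ideal := (chi_ideal beta N chiN).

Lemma contr_lift_bdE U : contr_lift M chi x (bd beta chi U) = (-1) ^+ #|U| *: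
  \sum_(i in U) ((-1) ^+ nabove U i * chi (U :\ i)) *: contr_lift M chi x (e (U :\ i)).
Proof.
rewrite bdE linearZ linear_sum /=; congr (_ *: _).
by apply: eq_bigr => i _; rewrite linearZ.
Qed.

(* The factor chi(U - i) cancels against the denominator of p_x(e_(U - i)). *)
Lemma contr_lift_bd_term U i y : i \in U -> y \in U -> i != y -> par M x y ->
    U :\ i \in indep M ->
  ((-1) ^+ nabove U i * chi (U :\ i)) *: contr_lift M chi x (e (U :\ i)) =
  - ((-1) ^+ nabove U y * (-1) ^+ nabove (U :\ y) i * chiN (U :\ y :\ i))
    *: e (U :\ y :\ i).
Proof.
move=> iU yU niy pxy iUi.
have yUi : y \in U :\ i by rewrite !inE eq_sym niy.
rewrite (contr_lift_par chiM ix iUi yUi pxy) scalerA setD1AC; congr (_ *: _).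
have yW : y \notin U :\ i :\ y by rewrite !inE eqxx.
rewrite [chi_contract chi y _]chi_contractE -?(setD1AC U i y) // setD1K //.
have chi0 : chi (U :\ i) != 0 by case: chiM => -> //; apply: (@indep_ground _ M).
rewrite -mulNr -(sign_nabove_swap K iU yU niy) invfM invr_sign.
by rewrite [RHS]mulrAC; field.
Qed.

Lemma contr_lift_bd_ideal U C : circuit M C -> (1 < #|C|)%N ->
    U \subset ground M -> C \subset U ->
    (forall D, D \subset U -> (D \notin indep M) = (C \subset D)) ->
  contr_lift M chi x (bd beta chi U) \in ideal.
Proof.
move=> cC gt1 sU sCU UC; rewrite contr_lift_bdE.
have depi i : i \notin C -> U :\ i \notin indep M.
  by move=> iC; rewrite UC ?subsetDl // subsetD1 sCU.
have indi i : i \in C -> U :\ i \in indep M.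
  by move=> iC; rewrite -[_ \in _]negbK UC ?subsetDl // subsetD1 iC andbF.
case: (pickP [pred y in U | par M x y]) => [y /= /andP[yU pxy]|np]; last first.
  rewrite big1 ?scaler0 ?mem0v // => i iU; rewrite contr_lift_nopar ?scaler0 // => y.
  by rewrite inE => /andP[_ yU]; have /= := np y; rewrite yU /= => ->.
(* Two distinct elements parallel to [x] form a dependent pair, hence all of [C]. Only the terms
   omitting one of them survive, and these cancel. *)
case: (pickP [pred z in U | par M x z && (z != y)]) => [z /= /and3P[zU pxz nzy]|uniqy].
  have Cyz : C = [set y; z].
    apply/eqP; rewrite eqEcard cards2 eq_sym nzy gt1 andbT -UC.
      apply: contraNN nzy => iyz; apply/eqP.
      by apply: (par_indep_eq iyz ix _ _ pxz pxy); rewrite !inE eqxx ?orbT.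
    by rewrite subUset !sub1set yU.
  rewrite (bigD1 y) //= (bigD1 z) /= ?zU // big1 ?addr0 => [|i]; last first.
    case/andP => /andP[_ niy] niz; rewrite contr_lift_dep ?scaler0 //.
    by apply: depi; rewrite Cyz !inE negb_or niy.
  have yC : y \in C by rewrite Cyz !inE eqxx.
  have zC : z \in C by rewrite Cyz !inE eqxx orbT.
  rewrite (contr_lift_bd_term zU yU nzy pxy (indi z zC)).
  rewrite (contr_lift_bd_term yU zU _ pxz (indi y yC)) 1?eq_sym //.
  rewrite (setD1AC U z y) -scalerDl.
  set a := (X in X *: e _); suff -> : a = 0 by rewrite scale0r scaler0 mem0v.
  have nyz : y != z by rewrite eq_sym.
  have := sign_nabove_swap K yU zU nyz; rewrite nabove_removexx => sw.
  by rewrite /a sw; ring.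
have {}uniqy z : z \in U -> par M x z -> z = y.
  by move=> zU pxz; apply/eqP/negPn/negP => nzy; have := uniqy z; rewrite /= zU pxz nzy.
have [cCy sUy UyC] := contract_par_circuit ix yU pxy cC sU sCU UC uniqy.
have chiN_alg := contract_chi_algebra beta_neq0 ix chiM.
have bdN : bd beta chiN (U :\ y) \in ideal.
  apply: (bd_unidependent_ideal chiN_alg cCy) => //; last by rewrite setSD.
  (* The circuit [C :\ y] must not be a loop of [M / x]: its single element [z] would be parallel to
     [x] in [M], against the uniqueness of [y]. *)
  rewrite ltnNge; apply/negP => leC.
  have yC : y \in C.
    by apply: contraLR gt1 => yC; rewrite -leqNgt (cardsD1 y C) (negbTE yC).
  have /cards1P[z eC] : #|C :\ y| == 1.
    by rewrite eqn_leq leC; move: gt1; rewrite (cardsD1 y C) yC.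
  have zCy : z \in C :\ y by rewrite eC inE.
  have /setD1P[/eqP nzy zC] := zCy; apply/nzy/uniqy; first exact: (subsetP sCU).
  apply: dep_par => //.
    apply: (indepS _ (indi y yC)); rewrite sub1set (subsetP _ _ zCy) //.
    by rewrite setSD.
  have : [set z] \notin indep N by rewrite -eC UyC // setSD.
  rewrite contract_indepP // negb_and inE => /orP[|//].
  rewrite negbK => /eqP exz; case: nzy; apply: uniqy; last by rewrite exz parxx.
  exact: (subsetP sCU).
(* The term omitting [y] vanishes, as nothing parallel to [x] is left; the others form the boundary
   of [U :\ y] up to sign. *)
rewrite (bigD1 y) //= contr_lift_nopar ?scaler0 ?add0r => [|z]; last first.
  by case/setD1P => /eqP nzy zU; apply/negP => /(uniqy z zU).
set S := (X in _ *: X).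
suff -> : S = - ((-1) ^+ nabove U y * (-1) ^+ #|U :\ y|) *: bd beta chiN (U :\ y).
  by do 2!apply: memvZ.
rewrite bdE scalerA mulNr -mulrA -expr2 sqrr_sign mulr1 scaler_sumr /S.
apply: eq_big => [i|i /andP[iU niy]]; first by rewrite !inE andbC.
rewrite scalerA; case: (boolP (i \in C)) => iC.
  by rewrite (contr_lift_bd_term iU yU niy pxy (indi i iC)) !mulNr mulrA.
rewrite contr_lift_dep ?depi // scaler0.
have sW : U :\ y :\ i \subset U :\ y by exact: subsetDl.
(* For [i] outside [C] both sides vanish: [U :\ i] is dependent in [M], and [U :\ y :\ i] is
   dependent in [M / x], where (UC1) applies. *)
suff -> : chiN (U :\ y :\ i) = 0 by rewrite !mulr0 scale0r.
have [UC1 _] := chiN_alg; apply/eqP; rewrite -[_ == 0]negbK UC1; last exact: subset_trans sUy.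
by rewrite UyC // subsetD1 setSD // !inE (negbTE iC) andbF.
Qed.

(* If C :|: X contains a second circuit, every monomial of bd C * e_X is
   dependent; otherwise (UC2) identifies bd C * e_X with bd (C :|: X). *)
Lemma contr_lift_ideal f : f \in chi_ideal beta M chi ->
  contr_lift M chi x f \in ideal.
Proof.
suff sub : (chi_ideal beta M chi <= linfun (contr_lift M chi x) @^-1: ideal)%VS.
  by move/(subvP sub); rewrite -memv_preim lfunE.
apply: chi_ideal_subP => [C X cC gt1 sX|i X li sX]; rewrite -memv_preim lfunE /=; last first.
  rewrite qgenE emonM; case: ifP => _; last by rewrite linear0 mem0v.
  rewrite linearZ /= contr_lift_dep ?scaler0 ?mem0v //.
  case/circuitP: li => _ di _; apply: contra di; apply: indepS; exact: subsetUl.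
have /circuitP[sC dC minC] := cC.
case: (boolP (unidependent M (C :|: X) && [disjoint C & X])) => [/andP[uU dCX]|nU].
  have /unidependentP[C' cC' [sU sC'U UC]] := uU.
  have eC : C' = C.
    apply/eqP; rewrite eqEsubset -UC ?subsetUl // dC /=.
    apply/subsetP => z zC; apply/negPn/negP => zC'.
    have := minC z zC; rewrite -[_ \in _]negbK UC; last first.
      exact: subset_trans (subsetDl _ _) (subsetUl _ _).
    by rewrite subsetD1 zC' -UC ?subsetUl // dC.
  rewrite {C'}eC in cC' sC'U UC.
  have uC : unidependent M C.
    apply/unidependentP; exists C => //; split=> // D sD.
    by apply: UC; apply: subset_trans sC'U.
  have [_ UC2] := chiM; have [eps eps0] := UC2 _ _ uU uC sC'U.
  rewrite setDUl setDv set0U (setDidPl _); last by rewrite disjoint_sym.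
  move/(congr1 ( *:%R eps^-1)); rewrite scalerA mulVf // scale1r => <-.
  by rewrite linearZ; apply/memvZ/(contr_lift_bd_ideal cC).
rewrite bdE -scalerAl big_distrl linearZ /= [contr_lift _ _ _ _]linear_sum big1 ?scaler0 ?mem0v //.
move=> i iC.
rewrite -scalerAl linearZ /= emonM; case: ifP => [dX|_]; last by rewrite linear0 scaler0.
rewrite linearZ /= contr_lift_dep ?scaler0 //.
apply: contra nU => iU.
have iX : i \notin X.
  apply: contra dC => iX; apply: indepS iU; apply/subsetP => z zC; rewrite !inE zC.
  by case: eqVneq => // ->; rewrite iX.
have dCX : [disjoint C & X].
  by rewrite disjoints_subset -(setD1K iC) subUset sub1set inE iX -disjoints_subset.
rewrite dCX andbT; apply: (@unidependent_remove _ _ _ i).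
- by rewrite subUset sC.
- by apply: contra dC; apply: indepS; apply: subsetUl.
- by rewrite inE iC.
by rewrite setDUl [X :\ i](setDidPl _) // disjoint_sym disjoints1.
Qed.

(** Independence of the representative: the one chosen by [quot_repr] differs from [v] by an element
    of the ideal, which p_x sends into the ideal of [M / x]. *)
Lemma proj_quot_class v : v \in qext_on beta (ground M) ->
  proj beta M chi x (quot_class (qext_on beta (ground M)) (chi_ideal beta M chi) v)
  = quot_class (qext_on beta (ground N)) ideal (contr_lift M chi x v).
Proof.
move=> vW; rewrite /proj 2!comp_lfunE [linfun (contr_lift _ _ _) _]lfunE.
apply/eqP; rewrite eq_sym -subr_eq0 -!linearB /=.
have vI := contr_lift_ideal (sub_quot_repr_mem _ vW).
by rewrite quot_class_eq0 // (subvP (chi_ideal_sub_qext_on beta N chiN)).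
Qed.

Lemma proj_class_par y J : J \in indep M -> y \in J -> par M x y ->
  proj beta M chi x (class_of beta M chi J) =
  (chi_contract chi x (J :\ y) / chi_contract chi y (J :\ y)) *:
    class_of beta N chiN (J :\ y).
Proof.
move=> iJ yJ pxy; rewrite /class_of proj_quot_class ?(contr_lift_par chiM ix iJ yJ) ?linearZ //.
exact/emon_qext_on/(@indep_ground _ M).
Qed.

Lemma proj_class_nopar J : J \in indep M -> (forall y, y \in J -> ~~ par M x y) ->
  proj beta M chi x (class_of beta M chi J) = 0.
Proof.
move=> iJ np; rewrite /class_of proj_quot_class ?contr_lift_nopar ?linear0 //.
exact/emon_qext_on/(@indep_ground _ M).
Qed.

Lemma proj_class_mem J : J \in indep M -> x \in J ->
  proj beta M chi x (class_of beta M chi J) = class_of beta N chiN (J :\ x).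
Proof.
move=> iJ xJ; rewrite (proj_class_par iJ xJ (parxx _ _)) divff ?scale1r //.
by rewrite (chi_contract_neq0 chiM) ?setD1K // !inE eqxx.
Qed.

End ContractIdeal.

(** * Successively parallel sequences and their flags *)

Section ParallelSequences.
Variable T : finType.
Implicit Types (M : matroid T) (s t : seq T) (x y : T).

Lemma set_cons x s : [set i in x :: s] = x |: [set i in s].
Proof. by apply/setP => i; rewrite !inE. Qed.

Lemma contract_indep_cons M x t : uniq (x :: t) -> [set i in x :: t] \in indep M ->
  [set x] \in indep M /\ [set i in t] \in indep (contract M x).
Proof.
rewrite set_cons /= => /andP[xt _] ixt.
have ix : [set x] \in indep M by apply: indepS ixt; apply: subsetUl.
by split; rewrite // contract_indepP // inE xt.
Qed.

(* The k-th entries of t and s are equal or parallel once the first k - 1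
   entries of t have been contracted. *)
Fixpoint par_seq M t s : bool :=
  match t, s with
  | x :: t', y :: s' => par M x y && par_seq (contract M x) t' s'
  | [::], [::] => true
  | _, _ => false
  end.

Lemma par_seq_size M t s : par_seq M t s -> size t = size s.
Proof. by elim: t M s => [|x t IHt] M [|y s] //= /andP[_ /IHt ->]. Qed.

(** Induction after contracting the head [x] of [t]. The tail of [s] is independent in [M / x] since
    [x] can replace the head [y]; [cl_contract] returns to [M], and [cl_par] then exchanges [x] for
    [y]. *)
Lemma cl_par_seq M t s k : uniq t -> [set i in t] \in indep M ->
  uniq s -> [set i in s] \in indep M -> par_seq M t s ->
  cl M [set i in take k t] = cl M [set i in take k s].
Proof.
elim: t M s k => [|x t IHt] M [|y s] [|k] //= ut it us iS /andP[pxy pts].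
have [ix itN] := contract_indep_cons ut it.
have [iy _] := contract_indep_cons us iS.
case/andP: ut => xt ut; case/andP: us => ys us.
have isN : [set i in s] \in indep (contract M x).
  have -> : [set i in s] = [set i in y :: s] :\ y by rewrite set_cons setU1K ?inE.
  by apply: par_contract_indep; rewrite // !inE eqxx.
have xs : x \notin [set i in s] by move: isN; rewrite contract_indepP // => /andP[].
have xtk : x \notin [set i in take k t].
  by rewrite inE; apply: contra xt; apply: mem_take.
have xsk : x \notin [set i in take k s].
  by rewrite inE in xs; rewrite inE; apply: contra xs; apply: mem_take.
rewrite !set_cons cl_contract // (IHt _ s) // -cl_contract //; exact: cl_par.
Qed.

(** The reversals match the convention that [flag] starts from the last entry, the one contracted
    first. *)
Lemma flag_par_seq M t s : uniq t -> [set i in t] \in indep M ->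
  uniq s -> [set i in s] \in indep M -> par_seq M t s ->
  flag M (rev s) = flag M (rev t).
Proof.
move=> ut it us iS pts; rewrite /flag !revK !size_rev (par_seq_size pts).
by apply: eq_map => k; rewrite (cl_par_seq k.+1 ut it us iS pts).
Qed.

End ParallelSequences.

(** * Evaluation of iterated contractions on independent classes *)

Section Duality.
Variables (K : fieldType) (n : nat) (beta : 'I_n -> 'I_n -> K).
Hypothesis beta_neq0 : forall i j : 'I_n, (i < j)%N -> beta i j != 0.
Implicit Types (M : matroid 'I_n) (chi : {set 'I_n} -> K) (t s : seq 'I_n).

(** Each contraction erases its own element with coefficient 1. *)
Lemma proj_seq_self t M chi : is_chi_algebra beta M chi -> uniq t ->
  [set i in t] \in indep M ->
  proj_seq beta t M chi (class_of beta M chi [set i in t])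
  = class_of beta (contract_seq M t) (chi_contract_seq chi t) set0.
Proof.
elim: t M chi => [|x t IHt] M chi chiM ut it.
  by rewrite /= id_lfunE; congr class_of; apply/setP => i; rewrite !inE.
have [ix itN] := contract_indep_cons ut it; case/andP: ut => xt ut.
rewrite [proj_seq _ _ _ _]/= comp_lfunE proj_class_mem ?inE ?eqxx //.
rewrite set_cons setU1K ?inE //; apply: IHt => //.
exact: contract_chi_algebra.
Qed.

(** Either some contraction meets no parallel element and gives 0, or the elements met, in order,
    form [s]. The scalars on the way do not matter, since only vanishing is claimed. *)
Lemma proj_seq_par t M chi J : is_chi_algebra beta M chi -> uniq t ->
  [set i in t] \in indep M -> J \in indep M -> #|J| = size t ->
  proj_seq beta t M chi (class_of beta M chi J) = 0 \/
  exists s, [/\ uniq s, [set i in s] = J & par_seq M t s].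
Proof.
elim: t M chi J => [|x t IHt] M chi J chiM ut it iJ cJ.
  by right; exists [::]; split=> //; apply/setP => i; rewrite (cards0_eq cJ) !inE.
have [ix itN] := contract_indep_cons ut it; case/andP: ut => xt ut.
rewrite [proj_seq _ _ _ _]/= comp_lfunE.
case: (pickP [pred y in J | par M x y]) => [y /= /andP[yJ pxy]|np]; last first.
  left; rewrite proj_class_nopar ?linear0 // => y yJ.
  by have /= := np y; rewrite yJ /= => ->.
rewrite (proj_class_par beta_neq0 chiM ix iJ yJ pxy) linearZ /=.
have [|||->|[s [us eJ pts]]] := IHt (contract M x) (chi_contract chi x) (J :\ y) _ ut itN.
- exact: contract_chi_algebra.
- exact: par_contract_indep.
- by move: cJ; rewrite (cardsD1 y) yJ => -[].
- by left; rewrite scaler0.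
right; exists (y :: s); rewrite set_cons eJ setD1K //= us pxy; split=> //.
have : y \notin [set i in s] by rewrite eJ !inE eqxx.
by rewrite inE => ->.
Qed.

Lemma coord_class0 M chi :
  coord [tuple class_of beta M chi set0] ord0 (class_of beta M chi set0) = 1.
Proof.
have fr : free [tuple class_of beta M chi set0] by rewrite seq1_free class_of_set0_neq0.
by have := coord_free ord0 ord0 fr; rewrite eqxx.
Qed.

End Duality.

(** * From dual functionals to a basis *)

Lemma free_dual (K : fieldType) (vT : vectType K) (s : seq vT) : uniq s ->
  (forall v, v \in s -> exists f : 'Hom(vT, K^o), forall w, w \in s -> f w = (w == v)%:R) ->
  free s.
Proof.
move=> us dual; rewrite -[s]in_tupleE; apply/freeP => a sum0 i.
have iS : s`_i \in s by rewrite mem_nth.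
have [f fE] := dual _ iS.
have := congr1 f sum0; rewrite linear_sum linear0 (bigD1 i) //= big1 ?addr0 => [|j nji].
  by rewrite linearZ /= fE // eqxx => /eqP; rewrite mulf_eq0 oner_eq0 orbF => /eqP.
by rewrite linearZ /= fE ?mem_nth // nth_uniq // (inj_eq val_inj) (negbTE nji) scaler0.
Qed.

Theorem theorem2p11 (K : fieldType) (n : nat) (beta : 'I_n -> 'I_n -> K)
    (M : matroid 'I_n) (chi : {set 'I_n} -> K) (l : nat)
    (B : {set {set 'I_n}}) (sigma : forall I : {set 'I_n}, 'S_#|I|) :
  (forall i j : 'I_n, (i < j)%N -> beta i j != 0) ->
  ground M = [set: 'I_n] ->
  is_chi_algebra beta M chi ->
  diagonal_basis beta M chi l B sigma ->
  basis_of (chi_alg_deg beta M chi l) (classes_of beta M chi B) /\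
  (forall I J : {set 'I_n}, I \in B -> J \in B ->
     proj_form beta M chi (listing (sigma I)) (class_of beta M chi J)
     = (I == J)%:R).
Proof.
move=> beta_neq0 gM chiM [Bind dimB diag].
have dual I J : I \in B -> J \in B ->
    proj_form beta M chi (listing (sigma I)) (class_of beta M chi J) = (I == J)%:R.
  move=> IB JB; have [iI cI] := Bind _ IB; have [iJ cJ] := Bind _ JB.
  set t := rev (listing (sigma I)).
  have ut : uniq t by rewrite rev_uniq listing_uniq.
  have tI : [set i in t] = I.
    by rewrite -[RHS](listing_set (sigma I)); apply/setP => i; rewrite !inE mem_rev.
  have it : [set i in t] \in indep M by rewrite tI.
  rewrite /proj_form -/t comp_lfunE lfunE /=.
  have [<-|nIJ] := eqVneq I J.
    by rewrite -[in class_of _ _ _ I]tI proj_seq_self // coord_class0.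
  have [|->|[s [us sJ pts]]] := proj_seq_par beta_neq0 chiM ut it iJ.
  - by rewrite size_rev size_listing cI.
  - by rewrite linear0.
  (* Read backwards, [s] is a listing of [J] with the flag of the chosen listing of [I], so
     condition (3) applies. *)
  have [||tau etau] := @listing_surj _ J (rev s).
  - by rewrite rev_uniq.
  - by rewrite -sJ; apply/setP => i; rewrite !inE mem_rev.
  case/eqP: nIJ; apply/esym/(diag _ _ tau) => //.
  by rewrite etau -[listing (sigma I)]revK; apply: flag_par_seq; rewrite ?sJ.
split=> //; rewrite basisEfree dimB andbT; apply/andP; split.
  apply: free_dual => [|v]; first exact: undup_uniq.
  rewrite mem_undup => /mapP[I]; rewrite mem_enum => IB ->.
  exists (proj_form beta M chi (listing (sigma I))) => w.
  rewrite mem_undup => /mapP[J]; rewrite mem_enum => JB ->; rewrite dual //.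
  case: (eqVneq I J) => [->|nIJ]; first by rewrite eqxx.
  (* Distinct members of [B] have distinct classes: otherwise the functional of [I] would take both
     values 1 and 0 on the common class. *)
  case: eqP => // eJI; have := dual I J IB JB; rewrite eJI dual // eqxx (negbTE nIJ).
  by move/eqP; rewrite oner_eq0.
apply/span_subvP => v; rewrite mem_undup => /mapP[I]; rewrite mem_enum => IB ->.
have [_ cI] := Bind _ IB.
by apply/memv_span/map_f; rewrite mem_enum inE gM subsetT cI /=.
Qed.
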